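(* Let $\sigma=(\sigma_0,\dots,\sigma_5)\in\{+,-\}^6$ and let $(P,N)$ be a pair of non-negative integers which is Descartes-compatible with $\sigma$. Then there exists a real polynomial of degree 5 with sign sequence $\sigma$ having exactly $P$ positive roots and exactly $N$ negative roots (counted with multiplicity), unless $(\sigma,(P,N))$ is trivially equivalent to $$\bigl((+,+,-,+,-,-),\,(3,0)\bigr),$$ in which case no such polynomial exists.
   Context: A real polynomial $Y(x)=a_0+a_1x+\cdots+a_dx^d$ of degree $d$ with all coefficients $a_0,\dots,a_d$ non-zero (a polynomial without gaps) has sign sequence $(\sigma_0,\dots,\sigma_d)$, where $\sigma_i$ is the sign of $a_i$; thus the first sign corresponds to the constant term. A variation in a sign sequence is an index $i$ with $\sigma_i=-\sigma_{i+1}$. A pair $(P,N)$ of non-negative integers is called Descartes-compatible with $\sigma=(\sigma_0,\dots,\sigma_d)$ if $k-P$ is even and non-negative, where $k$ is the number of variations of $\sigma$, and $k'-N$ is even and non-negative, where $k'$ is the number of variations of the sequence $((-1)^i\sigma_i)_{0\le i\le d}$. By Descartes' rule of signs, the numbers of positive and negative roots (counted with multiplicity) of a polynomial with sign sequence $\sigma$ always form a Descartes-compatible pair. Two such data $(\sigma,(P,N))$ are called trivially equivalent if one is obtained from the other by a composition of the following transformations: (1) changing $x$ into $-x$: $\bigl((\sigma_i)_{0\le i\le d},(P,N)\bigr)\mapsto\bigl(((-1)^i\sigma_i)_{0\le i\le d},(N,P)\bigr)$; (2) changing $x$ into $1/x$ (that is, $Y(x)$ into $x^dY(1/x)$): $\bigl((\sigma_i)_{0\le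 i\le d},(P,N)\bigr)\mapsto\bigl((\sigma_{d-i})_{0\le i\le d},(P,N)\bigr)$; (3) changing $Y$ into $-Y$: $\bigl((\sigma_i)_{0\le i\le d},(P,N)\bigr)\mapsto\bigl((-\sigma_i)_{0\le i\le d},(P,N)\bigr)$. *)

(* Defs.v *)
From Stdlib Require Import Relation_Operators.
From mathcomp Require Import all_boot all_order all_algebra.
From mathcomp Require Import reals.
From mathcomp Require Import polyrcf.

Set Implicit Arguments.
Unset Strict Implicit.
Unset Printing Implicit Defensive.

Import Order.TTheory GRing.Theory Num.Theory.
Local Open Scope ring_scope.

(* A sign is a boolean b standing for (-1) ^+ b; hence ~~ b is the opposite
   sign, and odd i (+) b is the sign (-1)^i b. *)
Definition sign := bool.
Definition plus : sign := false.
Definition minus : sign := true.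

(* The entry of index i is the sign of the coefficient of 'X^i, so the first
   sign is that of the constant term. *)
Definition sign_seq (d : nat) := d.+1.-tuple sign.

Definition variations (d : nat) (s : sign_seq d) : nat :=
  #|[set i : 'I_d | nth plus s i == ~~ nth plus s i.+1]|.

Definition alternate (d : nat) (s : sign_seq d) : sign_seq d :=
  [tuple odd i (+) tnth s i | i < d.+1].

Definition reverse (d : nat) (s : sign_seq d) : sign_seq d :=
  [tuple tnth s (rev_ord i) | i < d.+1].

Definition opposite (d : nat) (s : sign_seq d) : sign_seq d :=
  [tuple ~~ tnth s i | i < d.+1].

Definition descartes_compatible (d : nat) (s : sign_seq d) (PN : nat * nat) :
    Prop :=
  let k := variations s in
  let k' := variations (alternate s) in
  [/\ (PN.1 <= k)%N, ~~ odd (k - PN.1), (PN.2 <= k')%N & ~~ odd (k' - PN.2)].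

Definition datum (d : nat) : Type := (sign_seq d * (nat * nat))%type.

(* x |-> - x *)
Definition change_opp_x (d : nat) (a : datum d) : datum d :=
  (alternate a.1, (a.2.2, a.2.1)).

(* x |-> 1 / x *)
Definition change_inv_x (d : nat) (a : datum d) : datum d :=
  (reverse a.1, a.2).

(* Y |-> - Y *)
Definition change_opp_Y (d : nat) (a : datum d) : datum d :=
  (opposite a.1, a.2).

Definition trivial_step (d : nat) (a b : datum d) : Prop :=
  [\/ b = change_opp_x a, b = change_inv_x a | b = change_opp_Y a].

(* The three transformations are involutions, so this relation is symmetric. *)
Definition trivially_equivalent (d : nat) : datum d -> datum d -> Prop :=
  clos_refl_trans (datum d) (@trivial_step d).

Definition has_sign_seq (R : realType) (d : nat) (Y : {poly R})
    (s : sign_seq d) : Prop :=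
  size Y = d.+1 /\ forall i : 'I_d.+1, Num.sg Y`_i = (-1) ^+ tnth s i.

(* rootsR Y lists the distinct real roots of Y (when Y != 0), and mup x Y is
   the multiplicity of the root x. *)
Definition num_pos_roots (R : realType) (Y : {poly R}) : nat :=
  (\sum_(x <- rootsR Y | (0 < x)%R) mup x Y)%N.

Definition num_neg_roots (R : realType) (Y : {poly R}) : nat :=
  (\sum_(x <- rootsR Y | (x < 0)%R) mup x Y)%N.

Definition realizes (R : realType) (d : nat) (Y : {poly R}) (a : datum d) :
    Prop :=
  [/\ has_sign_seq Y a.1, num_pos_roots Y = a.2.1 & num_neg_roots Y = a.2.2].

Definition exceptional_datum : datum 5 :=
  ([tuple plus; plus; minus; plus; minus; minus], (3%N, 0%N)).

(* Main.v *)
Require Import Defs.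
From mathcomp Require Import all_boot all_order all_algebra.
From mathcomp Require Import reals polyrcf ring lra.
From Stdlib Require Import Relation_Operators.

(** A datum is a sign sequence together with a pair (P, N).  For every
    compatible datum outside the exceptional class a quintic is exhibited, as a
    product of linear factors and of quadratic factors without real roots, all
    with small integer coefficients: the numbers of positive and negative roots
    are read off the factors ([expand_root_count]), and the signs off the
    expanded product ([certified_realizable]).  One such product for each class
    under trivial equivalence is enough, since the three transformations act on
    products factor by factor.  There are 35 classes besides the exceptional one,
    and [certificates_complete] checks by evaluation that their certificates,
    together with the exceptional class, reach all compatible data.

    The exceptional class has only four members: reversing the exceptional
    sequence negates it, so the class is generated by Y |-> -Y and x |-> -x
    ([trivially_equivalent_exceptional]), and it is enough to rule out the
    representative.  Write its polynomial as Y = E + O with the even part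
    E = a0 - a2 x^2 - a4 x^4 and the odd part O = a1 x + a3 x^3 - a5 x^5, all
    ai > 0.  If Y has no negative root, then Y(0) = a0 > 0 forces
    Y(-x) = E(x) - O(x) > 0 for all x > 0, so that O < 0 at each positive root
    of Y.  By Descartes' rule O changes sign only once, and once negative it
    keeps decreasing; as E decreases on the positive axis, Y decreases strictly
    from its first positive root on, with a negative derivative there.  Hence Y
    has at most one positive root, and that root is simple
    ([exceptional_unrealizable]): three are impossible. *)

Set Implicit Arguments.
Unset Strict Implicit.
Unset Printing Implicit Defensive.

Import Order.TTheory GRing.Theory Num.Theory.
Local Open Scope ring_scope.

(** * Counting real roots with multiplicity *)

Section CountingRoots.
Variable R : rcfType.
Implicit Types (I : pred R) (p q : {poly R}) (x y : R).

Lemma mup_gt0 x p : p != 0 -> (0 < mup x p)%N = root p x.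
Proof. by move=> p0; rewrite mup_geq // expr1 dvdp_XsubCl. Qed.

Lemma mem_rootsR p x : p != 0 -> (x \in rootsR p) = root p x.
Proof. by move=> p0; rewrite -(roots_on_rootsR p0) in_itv. Qed.

Lemma uniq_rootsR p : uniq (rootsR p).
Proof. exact: uniq_roots. Qed.

Definition nroots I p : nat := (\sum_(x <- rootsR p | I x) mup x p)%N.

(** The list of summation may be enlarged, because points that are not roots
    have multiplicity zero.  This lets root counts of different polynomials be
    taken over a common list. *)
Lemma nroots_sum I p (s : seq R) :
  p != 0 -> uniq s -> {subset rootsR p <= s} ->
  (\sum_(x <- s | I x) mup x p)%N = nroots I p.
Proof.
move=> p0 us sub; apply: perm_big_supp_cond.
apply: uniq_perm; rewrite ?filter_uniq ?uniq_rootsR // => x.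
rewrite !mem_filter -!andbA; congr (_ && _).
rewrite -lt0n mup_gt0 // mem_rootsR //.
case: (boolP (root p x)) => //= px.
by rewrite sub // mem_rootsR.
Qed.

Lemma nroots_mul I p q :
  p != 0 -> q != 0 -> nroots I (p * q) = (nroots I p + nroots I q)%N.
Proof.
move=> p0 q0; have pq0 : p * q != 0 by rewrite mulf_neq0.
rewrite -(@nroots_sum I p (rootsR (p * q))) ?uniq_rootsR //; last first.
  by move=> x; rewrite !mem_rootsR // rootM => ->.
rewrite -(@nroots_sum I q (rootsR (p * q))) ?uniq_rootsR //; last first.
  by move=> x; rewrite !mem_rootsR // rootM orbC => ->.
rewrite -big_split /=.
by apply: eq_bigr => x _; rewrite mupM.
Qed.

Lemma nroots_rootless I p : (forall x, ~~ root p x) -> nroots I p = 0%N.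
Proof.
move=> pN; rewrite /nroots big1 // => x _.
by rewrite mupNroot.
Qed.

Lemma nrootsC I (c : R) : c != 0 -> nroots I c%:P = 0%N.
Proof. by move=> c0; apply: nroots_rootless => x; rewrite rootC. Qed.

Lemma nroots_XsubC I y : nroots I ('X - y%:P) = I y.
Proof.
rewrite -(@nroots_sum I _ [:: y]) ?polyXsubC_eq0 //; last first.
  by move=> x; rewrite mem_rootsR ?polyXsubC_eq0 // root_XsubC inE.
rewrite big_mkcond big_seq1 -(expr1 ('X - _)) mup_XsubCX eqxx.
by case: (I y).
Qed.

Lemma nrootsN I p : p != 0 -> nroots I (- p) = nroots I p.
Proof.
move=> p0; rewrite -mulN1r -(rmorphN1 (@polyC R)).
by rewrite nroots_mul ?polyC_eq0 ?oppr_eq0 ?oner_eq0 // nrootsC ?oppr_eq0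
  ?oner_eq0.
Qed.

Lemma comp_polyNXK p : (p \Po - 'X) \Po - 'X = p.
Proof.
by rewrite -comp_polyA [(- 'X) \Po _]raddfN /= comp_polyX opprK comp_polyXr.
Qed.

Lemma comp_polyNX_eq0 p : (p \Po - 'X == 0) = (p == 0).
Proof. by rewrite comp_poly2_eq0 // size_polyN size_polyX. Qed.

Lemma coef_comp_polyNX p i : (p \Po - 'X)`_i = (-1) ^+ i * p`_i.
Proof.
have -> : p \Po - 'X = \poly_(j < size p) ((-1) ^+ j * p`_j).
  rewrite comp_polyE poly_def; apply: eq_bigr => j _.
  rewrite [(- 'X) ^+ _]exprNn -signr_odd mulr_sign -[in RHS]signr_odd mulr_sign.
  by case: (odd j); rewrite ?scalerN ?scaleNr.
rewrite coef_poly; case: ltnP => // le_pi.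
by rewrite nth_default // mulr0.
Qed.

(** Substituting -X in a power of X + x that divides p gives, up to sign, the
    same power of X - x.  The reverse inequality follows as the substitution is
    an involution. *)
Lemma mup_comp_polyNX_ge x p :
  p != 0 -> (mup (- x) p <= mup x (p \Po - 'X))%N.
Proof.
move=> p0; rewrite mup_geq ?comp_polyNX_eq0 //.
have: ('X - (- x)%:P) ^+ mup (- x) p %| p by rewrite -mup_geq.
move/(dvdp_comp_poly (- 'X)); apply: dvdp_trans.
rewrite rmorphXn /= comp_polyB comp_polyX comp_polyC polyCN -opprD exprNn.
by rewrite dvdp_mull.
Qed.

Lemma mup_comp_polyNX x p : p != 0 -> mup x (p \Po - 'X) = mup (- x) p.
Proof.
move=> p0; apply/eqP; rewrite eqn_leq mup_comp_polyNX_ge // andbT.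
have := @mup_comp_polyNX_ge (- x) (p \Po - 'X).
by rewrite comp_polyNX_eq0 opprK comp_polyNXK; apply.
Qed.

Lemma nroots_comp_polyNX I p :
  p != 0 -> nroots I (p \Po - 'X) = nroots (fun x => I (- x)) p.
Proof.
move=> p0; rewrite -(@nroots_sum I _ [seq - x | x <- rootsR p]).
- rewrite big_map /nroots; apply: eq_bigr => x _.
  by rewrite (mup_comp_polyNX (- x) p0) opprK.
- by rewrite comp_polyNX_eq0.
- by rewrite map_inj_uniq ?uniq_rootsR //; apply: oppr_inj.
move=> x; rewrite mem_rootsR ?comp_polyNX_eq0 // root_comp hornerN hornerX.
by rewrite -mem_rootsR // => xp; apply/mapP; exists (- x); rewrite ?opprK.
Qed.

Lemma nroots_le1 I p :
  p != 0 ->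
  {in I, forall x, root p x -> p^`().[x] != 0} ->
  {in I &, forall x y, root p x -> root p y -> x = y} ->
  (nroots I p <= 1)%N.
Proof.
move=> p0 simple unique.
have mup_le1 x : I x -> (mup x p <= 1)%N.
  move=> Ix; rewrite leqNgt; apply/negP => mup2.
  have px : root p x by rewrite -mup_gt0 // ltnW.
  have /dvdpP[q def_p] : ('X - x%:P) ^+ 2 %| p by rewrite -mup_geq.
  move: (simple x Ix px); rewrite def_p expr2 !derivM.
  by rewrite !hornerE subrr /= !(mulr0, mul0r, addr0) eqxx.
rewrite /nroots -big_filter.
have: all (fun x => I x && root p x) [seq x <- rootsR p | I x].
  by apply/allP => x; rewrite mem_filter mem_rootsR.
have: uniq [seq x <- rootsR p | I x] by rewrite filter_uniq ?uniq_rootsR.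
case: [seq x <- rootsR p | I x] => [|x [|y s]]; first by rewrite big_nil.
  by rewrite big_seq1 => _ /= /andP[/andP[Ix _] _]; apply: mup_le1.
rewrite /= inE negb_or => /andP[/andP[/eqP neq_xy _] _].
by case/and3P=> /andP[Ix px] /andP[Iy py] _; case: neq_xy; apply: unique.
Qed.

End CountingRoots.

(** * Products of linear and definite quadratic factors *)

Section Certificates.
Variable R : realType.

(** Polynomials with integer coefficients are handled as lists, lowest degree
    first, so that products can be evaluated; [real_poly] interprets them. *)
Fixpoint add_coefs (s t : seq int) : seq int :=
  match s, t with
  | a :: s', b :: t' => a + b :: add_coefs s' t'
  | [::], _ => t
  | _, [::] => s
  end.

Definition mul_coefs (s t : seq int) : seq int :=
  foldr (fun a r => add_coefs [seq a * b | b <- t] (0 :: r)) [::] s.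

Definition expand (fs : seq (seq int)) : seq int :=
  foldr mul_coefs [:: 1] fs.

Definition real_poly (s : seq int) : {poly R} := Poly [seq a%:~R | a <- s].

Lemma real_poly_cons a s : real_poly (a :: s) = real_poly s * 'X + a%:~R%:P.
Proof. exact: cons_poly_def. Qed.

Lemma real_poly_nil : real_poly [::] = 0.
Proof. by []. Qed.

Lemma real_poly_add s t :
  real_poly (add_coefs s t) = real_poly s + real_poly t.
Proof.
elim: s t => [|a s IH] [|b t] /=; rewrite ?real_poly_nil ?add0r ?addr0 //.
by rewrite !real_poly_cons IH rmorphD /= polyCD; ring.
Qed.

Lemma real_poly_scale a s :
  real_poly [seq a * b | b <- s] = a%:~R%:P * real_poly s.
Proof.
elim: s => [|b s IH] /=; first by rewrite real_poly_nil mulr0.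
by rewrite !real_poly_cons IH rmorphM /= polyCM; ring.
Qed.

Lemma real_poly_mul s t :
  real_poly (mul_coefs s t) = real_poly s * real_poly t.
Proof.
elim: s => [|a s IH] /=; first by rewrite real_poly_nil mul0r.
rewrite real_poly_add real_poly_scale !real_poly_cons IH; ring.
Qed.

(** A nonzero constant, a linear factor whose root is not 0, or a quadratic
    factor of negative discriminant: factors whose real roots are apparent. *)
Definition elementary (f : seq int) : bool :=
  match f with
  | [:: c] => c != 0
  | [:: a; b] => a * b != 0
  | [:: a; b; c] => b * b < 4%Z * a * c
  | _ => false
  end.

Definition has_pos_root (f : seq int) : bool :=
  if f is [:: a; b] then a * b < 0 else false.

Definition has_neg_root (f : seq int) : bool :=
  if f is [:: a; b] then 0 < a * b else false.

(** Otherwise (2cx + b)^2 would equal the negative discriminant. *)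
Lemma quadratic_rootless (a b c x : R) :
  b * b < 4 * a * c -> a + b * x + c * x ^+ 2 != 0.
Proof.
by move=> disc; apply/eqP => eq0; have := sqr_ge0 (2 * c * x + b); nra.
Qed.

(** Multiply by b^2 > 0. *)
Lemma linear_root_sign (a b : R) : b != 0 ->
  ((0 < - a / b) = (a * b < 0)) * ((- a / b < 0) = (0 < a * b)).
Proof.
move=> b0; have bb0 : 0 < b * b by rewrite -expr2 exprn_even_gt0.
rewrite -(pmulr_lgt0 (- a / b) bb0) -(pmulr_llt0 (- a / b) bb0).
have -> : - a / b * (b * b) = - (a * b) by field.
by rewrite oppr_gt0 oppr_lt0.
Qed.

Lemma elementary_root_count (I : pred R) (f : seq int) : elementary f ->
  (real_poly f != 0) *
  (nroots I (real_poly f) =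
   if f is [:: a; b] then I (- a%:~R / b%:~R) : nat else 0%N).
Proof.
case: f => [|a [|b [|c []]]] //=.
- move=> a0; rewrite real_poly_cons mul0r add0r.
  have c0 : (a%:~R : R) != 0 by rewrite intr_eq0.
  by rewrite polyC_eq0 c0 nrootsC.
- rewrite mulf_eq0 negb_or => /andP[a0 b0].
  have rb0 : (b%:~R : R) != 0 by rewrite intr_eq0.
  have -> : real_poly [:: a; b] =
      (b%:~R)%:P * ('X - (- a%:~R / b%:~R)%:P).
    rewrite !real_poly_cons real_poly_nil mul0r add0r mulrBr -polyCM.
    by rewrite [_ * (_ / _)]mulrC divfK // polyCN opprK.
  have p0 : (b%:~R)%:P != 0 :> {poly R} by rewrite polyC_eq0.
  by rewrite nroots_mul ?mulf_neq0 ?polyXsubC_eq0 // nrootsC // nroots_XsubC.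
- move=> disc.
  have noroot x : ~~ root (real_poly [:: a; b; c]) x.
    have disc' : (b%:~R * b%:~R : R) < 4 * a%:~R * c%:~R.
      by rewrite -[4]/(4%:~R) -!intrM ltr_int.
    rewrite rootE !real_poly_cons real_poly_nil !hornerE.
    have -> : (c%:~R * x + b%:~R) * x + a%:~R =
        a%:~R + b%:~R * x + c%:~R * x ^+ 2 :> R by ring.
    exact: quadratic_rootless.
  rewrite nroots_rootless //; split=> //.
  by apply: contraNneq (noroot 0) => ->; rewrite root0.
Qed.

Lemma expand_root_count (I : pred R) (h : pred (seq int)) fs :
  all elementary fs ->
  {in fs, forall f, nroots I (real_poly f) = h f} ->
  (real_poly (expand fs) != 0) * (nroots I (real_poly (expand fs)) = count h fs).
Proof.
elim: fs => [_ _|f fs IH /andP[ef efs] hI] /=.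
  rewrite real_poly_cons mul0r add0r.
  by rewrite polyC1 oner_eq0 -polyC1 nrootsC ?oner_eq0.
have [|p0 np] := IH efs.
  by move=> g gfs; apply: hI; rewrite inE gfs orbT.
have [f0 _] := elementary_root_count I ef.
rewrite real_poly_mul mulf_neq0 // nroots_mul // np.
by rewrite hI ?inE ?eqxx.
Qed.

Definition valid_certificate (fs : seq (seq int)) : bool :=
  all elementary fs && all (fun c => c != 0) (expand fs).

Definition certified_datum (fs : seq (seq int)) : seq bool * (nat * nat) :=
  ([seq c < 0 | c <- expand fs],
   (count has_pos_root fs, count has_neg_root fs)).

Lemma certified_realizable d (s : sign_seq d) P N fs :
  valid_certificate fs -> certified_datum fs = (tval s, (P, N)) ->
  exists Y : {poly R}, realizes Y (s, (P, N)).
Proof.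
case/andP=> efs nz [sgn <- <-]; exists (real_poly (expand fs)); split=> /=.
- have sz : size (expand fs) = d.+1 by rewrite -(size_map (< 0)) sgn size_tuple.
  have nz_coef (i : nat) : (i < d.+1)%N -> (expand fs)`_i != 0.
    by move=> lti; apply: (allP nz); rewrite mem_nth ?sz.
  split=> [|i].
    rewrite /real_poly (@PolyK _ 0) ?size_map //.
    by rewrite -nth_last size_map sz /= (nth_map 0) ?sz // intr_eq0 nz_coef.
  rewrite coef_Poly (nth_map 0) ?sz // sgr_def intr_eq0 nz_coef // mulr1n ltrz0.
  by rewrite (tnth_nth plus) -sgn (nth_map 0) ?sz.
- suff count_f : {in fs, forall f : seq int,
      nroots (fun x : R => 0 < x) (real_poly f) = has_pos_root f}.
    exact: (expand_root_count efs count_f).2.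
  move=> f ffs.
  have ef := allP efs f ffs; rewrite (elementary_root_count _ ef).
  case: f ef {ffs} => [|a [|b []]] //=; rewrite mulf_eq0 negb_or => /andP[_ b0].
  by rewrite linear_root_sign ?intr_eq0 // -intrM ltrz0.
- suff count_f : {in fs, forall f : seq int,
      nroots (fun x : R => x < 0) (real_poly f) = has_neg_root f}.
    exact: (expand_root_count efs count_f).2.
  move=> f ffs.
  have ef := allP efs f ffs; rewrite (elementary_root_count _ ef).
  case: f ef {ffs} => [|a [|b []]] //=; rewrite mulf_eq0 negb_or => /andP[_ b0].
  by rewrite linear_root_sign ?intr_eq0 // -intrM ltr0z.
Qed.

End Certificates.

(** * Sign sequences as lists *)

(** The finite case distinction is settled by evaluation, for which sign
    sequences are taken as plain lists. *)
Definition list_variations (s : seq bool) : nat :=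
  count (fun i => nth plus s i == ~~ nth plus s i.+1) (iota 0 (size s).-1).

Definition list_alternate (s : seq bool) : seq bool :=
  mkseq (fun i => odd i (+) nth plus s i) (size s).

Lemma variationsE d (s : sign_seq d) : variations s = list_variations s.
Proof.
rewrite /variations /list_variations size_tuple /= -val_enum_ord count_map.
rewrite cardsE cardE {1}/enum_mem size_filter -enumT.
by apply: eq_count => i.
Qed.

Lemma alternateE d (s : sign_seq d) : alternate s = list_alternate s :> seq bool.
Proof.
rewrite /list_alternate size_tuple /mkseq -val_enum_ord -map_comp /=.
by apply: eq_map => i; rewrite /= (tnth_nth plus).
Qed.

Lemma oppositeE d (s : sign_seq d) : opposite s = map negb s :> seq bool.
Proof. by rewrite -[in RHS](map_tnth_enum s) -map_comp. Qed.

Lemma reverseE d (s : sign_seq d) : reverse s = rev s :> seq bool.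
Proof.
apply: (@eq_from_nth _ plus); rewrite ?size_rev ?size_tuple // => i lti.
rewrite nth_rev ?size_tuple // -[i]/(nat_of_ord (Ordinal lti)) nth_mktuple.
by rewrite (tnth_nth plus).
Qed.

Fixpoint sign_lists (n : nat) : seq (seq bool) :=
  if n is n'.+1 then
    [seq b :: s | b <- [:: plus; minus], s <- sign_lists n']
  else [:: [::]].

Lemma mem_sign_lists (s : seq bool) : s \in sign_lists (size s).
Proof.
elim: s => // b s IH; apply/allpairsP; exists (b, s); split=> //=.
by case: b.
Qed.

Definition list_compatible (a : seq bool * (nat * nat)) : bool :=
  let k := list_variations a.1 in
  let k' := list_variations (list_alternate a.1) in
  [&& (a.2.1 <= k)%N, ~~ odd (k - a.2.1), (a.2.2 <= k')%N & ~~ odd (k' - a.2.2)].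

Lemma list_compatibleP d (s : sign_seq d) P N :
  reflect (descartes_compatible s (P, N)) (list_compatible (tval s, (P, N))).
Proof.
rewrite /descartes_compatible !variationsE alternateE /list_compatible /=.
exact: and4P.
Qed.

Lemma variations_le d (s : sign_seq d) : (variations s <= d)%N.
Proof. by rewrite -[leqRHS]card_ord max_card. Qed.

Definition compatible_data : seq (seq bool * (nat * nat)) :=
  [seq a <- [seq (s, PN) | s <- sign_lists 6,
                           PN <- [seq (P, N) | P <- iota 0 6, N <- iota 0 6]]
     | list_compatible a].

Lemma mem_compatible_data (s : sign_seq 5) P N :
  descartes_compatible s (P, N) -> (tval s, (P, N)) \in compatible_data.
Proof.
move=> compat; rewrite mem_filter; apply/andP; split; first exact/list_compatibleP.
case: compat => [/leq_trans leP _ /leq_trans leN _].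
apply: allpairs_f; first by have := mem_sign_lists s; rewrite size_tuple.
by apply: allpairs_f; rewrite mem_iota ltnS ?(leP _ (variations_le _))
  ?(leN _ (variations_le _)).
Qed.

(** * The exceptional class *)

(** Closed under x |-> 1/x as well, because reversing the exceptional sequence
    gives its opposite. *)
Definition exceptional_orbit : seq (datum 5) :=
  let e := exceptional_datum in
  [:: e; change_opp_Y e; change_opp_x e; change_opp_x (change_opp_Y e)].

Definition list_datum d (a : datum d) : seq bool * (nat * nat) := (tval a.1, a.2).

Lemma list_datum_inj d : injective (@list_datum d).
Proof. by move=> [s PN] [t QM] [/val_inj -> ->]. Qed.

Definition exceptional_lists : seq (seq bool * (nat * nat)) :=
  [:: ([:: plus; plus; minus; plus; minus; minus], (3, 0));
      ([:: minus; minus; plus; minus; plus; plus], (3, 0));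
      ([:: plus; minus; minus; minus; minus; plus], (0, 3));
      ([:: minus; plus; plus; plus; plus; minus], (0, 3))]%N.

Lemma exceptional_orbitE :
  map (@list_datum 5) exceptional_orbit = exceptional_lists.
Proof.
by rewrite /list_datum /= !alternateE !oppositeE.
Qed.

Lemma alternateK d : involutive (@alternate d).
Proof.
by move=> s; apply: eq_from_tnth => i; rewrite !tnth_mktuple addbA addbb.
Qed.

Lemma oppositeK d : involutive (@opposite d).
Proof. by move=> s; apply: eq_from_tnth => i; rewrite !tnth_mktuple negbK. Qed.

Lemma reverseK d : involutive (@reverse d).
Proof.
by move=> s; apply: eq_from_tnth => i; rewrite !tnth_mktuple rev_ordK.
Qed.

Lemma trivial_step_sym d (a b : datum d) : trivial_step a b -> trivial_step b a.
Proof.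
case: a => [s [P N]] [] ->; [apply: Or31 | apply: Or32 | apply: Or33];
by rewrite /change_opp_x /change_inv_x /change_opp_Y /= ?alternateK ?reverseK
  ?oppositeK.
Qed.

Lemma exceptional_orbit_step (a b : datum 5) :
  trivial_step a b -> a \in exceptional_orbit -> b \in exceptional_orbit.
Proof.
have memE c : (c \in exceptional_orbit) = (list_datum c \in exceptional_lists).
  by rewrite -exceptional_orbitE mem_map //; apply: list_datum_inj.
rewrite !memE => step; case: a step => [s PN] step.
rewrite !inE => /or4P[] /eqP[sE PNE]; move: step;
by rewrite PNE => -[] ->;
  rewrite /list_datum /= ?alternateE ?reverseE ?oppositeE sE.
Qed.

Lemma trivially_equivalent_exceptional (a : datum 5) :
  trivially_equivalent a exceptional_datum <-> a \in exceptional_orbit.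
Proof.
split=> [|].
  move=> equiv; have: exceptional_datum \in exceptional_orbit by rewrite inE eqxx.
  elim: equiv => [b c step|//|b c e _ IHbc _ IHce /IHce/IHbc //].
  exact/exceptional_orbit_step/trivial_step_sym.
have sym_step b c : trivial_step b c -> trivially_equivalent c b.
  by move=> /trivial_step_sym; apply: rt_step.
have oppY_equiv :
    trivially_equivalent (change_opp_Y exceptional_datum) exceptional_datum.
  by apply: sym_step; apply: Or33.
rewrite !inE => /or4P[] /eqP -> //; first exact: rt_refl.
  by apply: sym_step; apply: Or31.
by apply: rt_trans oppY_equiv; apply: sym_step; apply: Or31.
Qed.

(** * Existence outside the exceptional class *)

Definition reflect_coefs (s : seq int) : seq int :=
  mkseq (fun i => (-1) ^+ i * s`_i) (size s).

(** The certificates of all data that are trivially equivalent to the given one.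
    The substitutions x |-> -x and x |-> 1/x act on each factor, by alternating
    or reversing its coefficients, and the constant factor -1 changes Y into -Y. *)
Definition symmetric_certificates (fs : seq (seq int)) : seq (seq (seq int)) :=
  let up_to_sign gs := [:: gs; [:: -1] :: gs] in
  let up_to_reflection gs :=
    up_to_sign gs ++ up_to_sign [seq reflect_coefs f | f <- gs] in
  up_to_reflection fs ++ up_to_reflection [seq rev f | f <- fs].

(** One product for each class of compatible data other than the exceptional
    one; the factor [:: a; b] is a + b x, and [:: a; b; c] is a + b x + c x^2. *)
Definition degree5_certificates : seq (seq (seq int)) := ([::
  [:: [:: 1; 1]; [:: 1; -2; 3]; [:: 1; -1; 1]];
  [:: [:: 1; 1]; [:: 1; 2; 2]; [:: 2; -3; 2]];
  [:: [:: 1; 1]; [:: 1; 0; 2]; [:: 3; -5; 3]];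
  [:: [:: 1; 1]; [:: 1; 1]; [:: 1; 1]; [:: 1; -1; 1]];
  [:: [:: 1; 1]; [:: 1; 1]; [:: 1; 1]; [:: 1; 1]; [:: 1; 1]];
  [:: [:: -1; 1]; [:: 2; -1; 2]; [:: 4; 7; 4]];
  [:: [:: -1; 1]; [:: 2; -2; 1]; [:: 4; 5; 2]];
  [:: [:: -1; 1]; [:: 1; -1; 1]; [:: 5; 7; 3]];
  [:: [:: -1; 1]; [:: 1; -1; 2]; [:: 4; 5; 2]];
  [:: [:: -3; 1]; [:: 1; 0; 1]; [:: 1; 1; 1]];
  [:: [:: -1; 1]; [:: 1; 2; 2]; [:: 2; -1; 2]];
  [:: [:: -1; 1]; [:: 1; -1; 1]; [:: 1; 1; 1]];
  [:: [:: -2; 1]; [:: 1; 1]; [:: 1; 1]; [:: 2; -1; 2]];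
  [:: [:: -1; 1]; [:: 1; 1]; [:: 1; 1]; [:: 3; -4; 3]];
  [:: [:: -1; 1]; [:: 1; 1]; [:: 1; 1]; [:: 2; 0; 1]];
  [:: [:: -1; 1]; [:: 1; 1]; [:: 1; 2]; [:: 1; -1; 1]];
  [:: [:: -1; 1]; [:: 1; 1]; [:: 1; 1]; [:: 1; 1]; [:: 1; 1]];
  [:: [:: -1; 1]; [:: -1; 2]; [:: 1; 1]; [:: 2; 1; 1]];
  [:: [:: -2; 1]; [:: -1; 1]; [:: 1; 1]; [:: 1; -1; 1]];
  [:: [:: -1; 1]; [:: -1; 1]; [:: 1; 1]; [:: 2; 1; 2]];
  [:: [:: -1; 1]; [:: -1; 1]; [:: 1; 2]; [:: 4; 2; 1]];
  [:: [:: -3; 1]; [:: -2; 1]; [:: 1; 1]; [:: 1; 0; 1]];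
  [:: [:: -1; 1]; [:: -1; 1]; [:: 1; 1]; [:: 1; 1]; [:: 1; 1]];
  [:: [:: -5; 1]; [:: -1; 2]; [:: 1; 1]; [:: 2; 1]; [:: 2; 1]];
  [:: [:: -1; 2]; [:: -1; 2]; [:: 2; 1]; [:: 3; 1]; [:: 4; 1]];
  [:: [:: -3; 1]; [:: -3; 1]; [:: -2; 1]; [:: 5; 6; 2]];
  [:: [:: -1; 1]; [:: -1; 1]; [:: -1; 2]; [:: 6; 3; 1]];
  [:: [:: -2; 1]; [:: -1; 1]; [:: -1; 1]; [:: 1; 3; 3]];
  [:: [:: -1; 1]; [:: -1; 1]; [:: -1; 1]; [:: 2; 3; 2]];
  [:: [:: -1; 1]; [:: -1; 1]; [:: -1; 1]; [:: 1; 2; 2]];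
  [:: [:: -4; 1]; [:: -3; 1]; [:: -1; 2]; [:: 1; 1]; [:: 1; 1]];
  [:: [:: -1; 1]; [:: -1; 1]; [:: -1; 1]; [:: 2; 1]; [:: 2; 1]];
  [:: [:: -1; 1]; [:: -1; 1]; [:: -1; 1]; [:: 1; 1]; [:: 3; 1]];
  [:: [:: -1; 1]; [:: -1; 1]; [:: -1; 1]; [:: -1; 1]; [:: 1; 2]];
  [:: [:: -1; 1]; [:: -1; 1]; [:: -1; 1]; [:: -1; 1]; [:: 5; 1]]])%Z.

Definition certificates : seq (seq (seq int)) :=
  flatten (map symmetric_certificates degree5_certificates).

Lemma certificates_valid : all valid_certificate certificates.
Proof. by vm_compute. Qed.

(** The case distinction of the existence part: each compatible datum is
    exceptional or certified. *)
Lemma certificates_complete :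
  all (mem (exceptional_lists ++ map certified_datum certificates))
    compatible_data.
Proof. by vm_compute. Qed.

(** * Non-existence for the exceptional class *)

Section Nonexistence.
Variable R : realType.

Definition exceptional_value (a0 a1 a2 a3 a4 a5 x : R) : R :=
  a0 + a1 * x - a2 * x ^+ 2 + a3 * x ^+ 3 - a4 * x ^+ 4 - a5 * x ^+ 5.

(** With E and O the even and odd parts, E + O = 0 < E - O at x, hence O < 0. *)
Lemma odd_part_neg (a0 a1 a2 a3 a4 a5 x : R)
    (Y := exceptional_value a0 a1 a2 a3 a4 a5) :
  0 < x -> Y x = 0 -> 0 < Y (- x) -> a1 + a3 * x ^+ 2 < a5 * x ^+ 4.
Proof.
move=> x0 Yx YNx; rewrite -subr_gt0 -(pmulr_rgt0 _ x0).
by move: Yx YNx; rewrite /Y /exceptional_value; lra.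
Qed.

(** The even part decreases on the positive axis.  The difference quotient of the
    odd part is
    a1 + a3 (z^2 + z x + x^2) - a5 (z^4 + z^3 x + z^2 x^2 + z x^3 + x^4),
    and it is negative because a5 x^2 exceeds a3 and a5 x^4 exceeds
    a1 + a3 x^2. *)
Lemma strictly_decreasing_after (a0 a1 a2 a3 a4 a5 x z : R)
    (Y := exceptional_value a0 a1 a2 a3 a4 a5) :
  0 < a1 -> 0 < a2 -> 0 < a3 -> 0 < a4 -> 0 < a5 ->
  0 < x -> x < z -> a1 + a3 * x ^+ 2 < a5 * x ^+ 4 -> Y z < Y x.
Proof.
move=> a1_gt0 a2_gt0 a3_gt0 a4_gt0 a5_gt0 x0 lt_xz oddN.
have a5x2 : a3 < a5 * x ^+ 2.
  have a5x4 : a3 * x ^+ 2 < a5 * x ^+ 4 by lra.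
  by rewrite -(ltr_pM2r (exprn_gt0 2 x0)) -mulrA -exprD.
have z0 : 0 < z by apply: lt_trans lt_xz.
have even_drop :
    a0 - a2 * z ^+ 2 - a4 * z ^+ 4 < a0 - a2 * x ^+ 2 - a4 * x ^+ 4.
  have sq : x ^+ 2 < z ^+ 2 by rewrite ltr_pXn2r // nnegrE ltW.
  have qu : x ^+ 4 < z ^+ 4 by rewrite ltr_pXn2r // nnegrE ltW.
  have t2 : a2 * x ^+ 2 < a2 * z ^+ 2 by rewrite ltr_pM2l.
  have t4 : a4 * x ^+ 4 < a4 * z ^+ 4 by rewrite ltr_pM2l.
  lra.
have slope : a1 + a3 * (z ^+ 2 + z * x + x ^+ 2)
    < a5 * (z ^+ 4 + z ^+ 3 * x + z ^+ 2 * x ^+ 2 + z * x ^+ 3 + x ^+ 4).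
  have t2 : a3 * z ^+ 2 < a5 * x ^+ 2 * z ^+ 2 by rewrite ltr_pM2r ?exprn_gt0.
  have t1 : a3 * (z * x) < a5 * x ^+ 2 * (z * x) by rewrite ltr_pM2r ?mulr_gt0.
  have t4 : 0 < a5 * z ^+ 4 by rewrite mulr_gt0 ?exprn_gt0.
  have t3 : 0 < a5 * (z ^+ 3 * x) by rewrite !mulr_gt0 ?exprn_gt0.
  have -> : a5 * (z ^+ 4 + z ^+ 3 * x + z ^+ 2 * x ^+ 2 + z * x ^+ 3 + x ^+ 4)
    = a5 * z ^+ 4 + a5 * (z ^+ 3 * x) + a5 * x ^+ 2 * z ^+ 2
      + a5 * x ^+ 2 * (z * x) + a5 * x ^+ 4 by ring.
  lra.
have odd_drop : a1 * z + a3 * z ^+ 3 - a5 * z ^+ 5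
    < a1 * x + a3 * x ^+ 3 - a5 * x ^+ 5.
  rewrite -subr_gt0; have dz : 0 < z - x by rewrite subr_gt0.
  have := mulr_gt0 dz (etrans (subr_gt0 _ _) slope).
  by congr (0 < _); ring.
by rewrite /Y /exceptional_value; lra.
Qed.

(** The infinitesimal form of the preceding lemma, with the derivative written
    out: a positive root of the polynomial is therefore simple. *)
Lemma derivative_neg (a1 a2 a3 a4 a5 x : R) :
  0 < a1 -> 0 < a2 -> 0 < a4 -> 0 < a5 -> 0 < x -> a1 + a3 * x ^+ 2 < a5 * x ^+ 4 ->
  a1 - 2 * a2 * x + 3 * a3 * x ^+ 2 - 4 * a4 * x ^+ 3 - 5 * a5 * x ^+ 4 < 0.
Proof.
move=> a1_gt0 a2_gt0 a4_gt0 a5_gt0 x0 oddN.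
have t1 : 0 < a2 * x by rewrite mulr_gt0.
have t3 : 0 < a4 * x ^+ 3 by rewrite mulr_gt0 ?exprn_gt0.
have t4 : 0 < a5 * x ^+ 4 by rewrite mulr_gt0 ?exprn_gt0.
lra.
Qed.

Lemma exceptional_unrealizable (Y : {poly R}) : ~ realizes Y exceptional_datum.
Proof.
case=> -[/= sY sgnY] posY negY.
have Y0 : Y != 0 by rewrite -size_poly_eq0 sY.
have sg_coef (i : 'I_6) : Num.sg Y`_i = (-1) ^+ nth plus exceptional_datum.1 i.
  by rewrite sgnY (tnth_nth plus).
have a0 : 0 < Y`_0 by rewrite -sgr_cp0 (sg_coef (@Ordinal 6 0 isT)).
have a1 : 0 < Y`_1 by rewrite -sgr_cp0 (sg_coef (@Ordinal 6 1 isT)).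
have a2 : 0 < - Y`_2.
  by rewrite oppr_gt0 -sgr_cp0 (sg_coef (@Ordinal 6 2 isT)).
have a3 : 0 < Y`_3 by rewrite -sgr_cp0 (sg_coef (@Ordinal 6 3 isT)).
have a4 : 0 < - Y`_4.
  by rewrite oppr_gt0 -sgr_cp0 (sg_coef (@Ordinal 6 4 isT)).
have a5 : 0 < - Y`_5.
  by rewrite oppr_gt0 -sgr_cp0 (sg_coef (@Ordinal 6 5 isT)).
have YE x : Y.[x] =
    exceptional_value Y`_0 Y`_1 (- Y`_2) Y`_3 (- Y`_4) (- Y`_5) x.
  rewrite horner_coef sY /exceptional_value !big_ord_recl big_ord0 /= /bump /=.
  ring.
have dYE x : Y^`().[x] = Y`_1 - 2 * (- Y`_2) * x + 3 * Y`_3 * x ^+ 2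
    - 4 * (- Y`_4) * x ^+ 3 - 5 * (- Y`_5) * x ^+ 4.
  have sdY : (size Y^`() <= 5)%N by rewrite -ltnS -sY lt_size_deriv.
  rewrite (horner_coef_wide _ sdY) !big_ord_recl big_ord0 !coef_deriv /= /bump /=.
  ring.
have no_neg_root x : x < 0 -> ~~ root Y x.
  move=> x0; apply/negP => Yx; move/eqP: negY.
  rewrite sum_nat_seq_eq0 => /allP/(_ x).
  by rewrite mem_rootsR // => /(_ Yx); rewrite x0 -leqn0 leqNgt mup_gt0 // Yx.
(* Otherwise Y would vanish between - x and 0, as Y takes the value a0 > 0 at 0. *)
have pos_at_neg x : 0 < x -> 0 < Y.[- x].
  move=> x0; rewrite ltNge; apply/negP => YNx.
  have leN0 : - x <= 0 by rewrite oppr_le0 ltW.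
  have [|z] := @poly_ivt _ Y (- x) 0 leN0.
    by rewrite YNx horner_coef0 ltW.
  move=> /andP[_].
  rewrite le_eqVlt => /predU1P[->|/no_neg_root/negP //].
  by rewrite rootE horner_coef0 (gt_eqF a0).
have oddN x : 0 < x -> root Y x -> Y`_1 + Y`_3 * x ^+ 2 < - Y`_5 * x ^+ 4.
  move=> x0 /rootP Yx; have := pos_at_neg x x0; move: Yx; rewrite !YE.
  exact: odd_part_neg.
suff: (num_pos_roots Y <= 1)%N by rewrite posY.
apply: (@nroots_le1 _ (fun x => 0 < x)) => // [x x0 Yx|].
  by rewrite dYE; apply/ltr0_neq0/derivative_neg => //; apply: oddN.
have no_later_root (x z : R) : 0 < x -> root Y x -> x < z -> ~~ root Y z.
  move=> x0 Yx lt_xz; rewrite rootE; apply/ltr0_neq0.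
  rewrite -(rootP Yx) !YE; apply: strictly_decreasing_after => //.
  exact: oddN.
move=> x z x0 z0 Yx Yz; apply/eqP; case: ltgtP => // lt.
  by have := no_later_root x z x0 Yx lt; rewrite Yz.
by have := no_later_root z x z0 Yz lt; rewrite Yx.
Qed.

Definition realizable d (a : datum d) : Prop := exists Y : {poly R}, realizes Y a.

Lemma realizable_opp_Y d (a : datum d) :
  realizable a -> realizable (change_opp_Y a).
Proof.
case=> Y [[sY sgnY] posY negY]; exists (- Y).
have Y0 : Y != 0 by rewrite -size_poly_eq0 sY.
split; last by rewrite -negY; apply: nrootsN.
  split=> [|i]; rewrite ?size_polyN // coefN sgrN sgnY tnth_mktuple.
  by rewrite signrN.
by rewrite -posY; apply: nrootsN.
Qed.

Lemma realizable_opp_x d (a : datum d) :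
  realizable a -> realizable (change_opp_x a).
Proof.
case=> Y [[sY sgnY] posY negY]; exists (Y \Po - 'X).
have Y0 : Y != 0 by rewrite -size_poly_eq0 sY.
split.
- split=> [|i]; first by rewrite size_comp_poly2 // size_polyN size_polyX.
  rewrite coef_comp_polyNX sgrM sgnY tnth_mktuple signr_addb.
  by rewrite sgrX sgrN1 signr_odd.
- rewrite /= -negY /num_pos_roots -/(nroots _ _) nroots_comp_polyNX //.
  by apply: eq_bigl => x; rewrite oppr_gt0.
rewrite /= -posY /num_neg_roots -/(nroots _ _) nroots_comp_polyNX //.
by apply: eq_bigl => x; rewrite oppr_lt0.
Qed.

Lemma exceptional_orbit_unrealizable (a : datum 5) :
  a \in exceptional_orbit -> ~ realizable a.
Proof.
have not_e : ~ realizable exceptional_datum.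
  by case=> Y; apply: exceptional_unrealizable.
have not_oppY : ~ realizable (change_opp_Y exceptional_datum).
  by move=> /realizable_opp_Y; rewrite /change_opp_Y /= oppositeK.
rewrite !inE => /or4P[] /eqP -> // /realizable_opp_x;
by rewrite {1}/change_opp_x /= alternateK.
Qed.

End Nonexistence.

Theorem mainTheorem3 (R : realType) (sigma : sign_seq 5) (P N : nat) :
  descartes_compatible sigma (P, N) ->
  (~ trivially_equivalent (sigma, (P, N)) exceptional_datum ->
     exists Y : {poly R}, realizes Y (sigma, (P, N))) /\
  (trivially_equivalent (sigma, (P, N)) exceptional_datum ->
     ~ exists Y : {poly R}, realizes Y (sigma, (P, N))).
Proof.
move=> compat; rewrite trivially_equivalent_exceptional; split; last first.
  exact: exceptional_orbit_unrealizable.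
move=> not_exceptional.
have := allP certificates_complete _ (mem_compatible_data compat).
rewrite inE mem_cat => /orP[|/mapP[fs fs_cert fs_datum]].
  rewrite -exceptional_orbitE -[(_, _)]/(list_datum (sigma, (P, N))) mem_map //.
  exact: list_datum_inj.
exact: certified_realizable (allP certificates_valid fs fs_cert) (esym fs_datum).
Qed.
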